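(* There is a temporally connected temporal path $\mathcal{P}$ and a temporally connected temporal cycle $\mathcal{C}$ such that there is no Nash equilibrium in the two-player temporal Voronoi game $\mathrm{Vor}(\mathcal{P},2)$ and no Nash equilibrium in the two-player temporal Voronoi game $\mathrm{Vor}(\mathcal{C},2)$.
   Context: A temporal graph $\mathcal{G}=(V,(E_t)_{t=1}^\infty)$ consists of a finite vertex set $V$ and edge sets $E_t\subseteq\binom{V}{2}$; it is assumed to have finite lifetime, i.e. there is $\tau$ with $E_t=E_\tau$ for all $t\ge\tau$. The underlying graph is $(V,\bigcup_t E_t)$. A temporal path (cycle) is a temporal graph whose underlying graph is a path (cycle). A temporal walk from $v_0$ to $v_d$ is a sequence $(\{v_0,v_1\},t_1),\dots,(\{v_{d-1},v_d\},t_d)$ with $t_1<t_2<\dots<t_d$ and $\{v_{i-1},v_i\}\in E_{t_i}$ for all $i$; its arrival time is $t_d$. $\mathrm{td}(u,v)$ is the smallest arrival time of a temporal walk from $u$ to $v$ ($\infty$ if none exists, and $\mathrm{td}(v,v)=0$). $\mathcal{G}$ is temporally connected if $\mathrm{td}(u,v)<\infty$ for all $u,v\in V$. Two-player temporal Voronoi game $\mathrm{Vor}(\mathcal{G},2)$: players $1,2$ choose vertices $p_1,p_2\in V$ simultaneously. The payoff of player $i$ is the number of vertices $v$ with $\mathrm{td}(p_i,v)<\mathrm{td}(p_j,v)$, where $j\ne i$ is the other player. A profile $(p_1,p_2)$ is a Nash equilibrium if no player can strictly increase her payoff by unilaterally choosing another vertex. *)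

(* Defs.v *)
From HB Require Import structures.
From mathcomp Require Import all_boot all_order all_algebra.
From mathcomp Require Import boolp constructive_ereal.

Set Implicit Arguments.
Unset Strict Implicit.
Unset Printing Implicit Defensive.

(* Time steps are 1, 2, 3, ...; [tedges0] makes the index 0 carry no data. *)
Record temporal_graph (V : finType) := TemporalGraph {
  tedges : nat -> {set {set V}};
  tedges0 : tedges 0 = set0;
  card_tedge : forall t e, e \in tedges t -> #|e| = 2;
  tedges_lifetime : exists tau, forall t, tau <= t -> tedges t = tedges tau
}.

Definition underlying (V : finType) (G : temporal_graph V) : {set {set V}} :=
  [set e | `[< exists t, e \in tedges G t >]].

Definition is_path_graph (V : finType) (E : {set {set V}}) : Prop :=
  exists (n : nat) (v : 'I_n -> V),
    [/\ 0 < n, bijective v &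
        E = [set [set v i; v j] | i in 'I_n, j in 'I_n & j == i.+1 :> nat]].

(* [ordS] is the cyclic successor on 'I_n. *)
Definition is_cycle_graph (V : finType) (E : {set {set V}}) : Prop :=
  exists (n : nat) (v : 'I_n -> V),
    [/\ 2 < n, bijective v & E = [set [set v i; v (ordS i)] | i : 'I_n]].

Definition temporal_path (V : finType) (G : temporal_graph V) : Prop :=
  is_path_graph (underlying G).

Definition temporal_cycle (V : finType) (G : temporal_graph V) : Prop :=
  is_cycle_graph (underlying G).

(* The walk ({v_0,v_1},t_1), ..., ({v_(d-1),v_d},t_d) from v_0 = u is encoded
   as the sequence s = [:: (v_1,t_1); ...; (v_d,t_d)]. *)
Definition temporal_walk (V : finType) (G : temporal_graph V)
    (u : V) (s : seq (V * nat)) : bool :=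
  path (fun x y : V * nat =>
          (x.2 < y.2) && ([set x.1; y.1] \in tedges G y.2)) (u, 0) s.

Definition arrives (V : finType) (G : temporal_graph V)
    (u v : V) (t : nat) : bool :=
  `[< exists s, temporal_walk G u s /\ last (u, 0) s = (v, t) >].

Definition td (V : finType) (G : temporal_graph V) (u v : V) : \bar int :=
  if u == v then 0%:Z%:E
  else match pselect (exists t, arrives G u v t) with
       | left ex_t => (ex_minn ex_t)%:Z%:E
       | right _ => +oo%E
       end.

Definition temporally_connected (V : finType) (G : temporal_graph V) : Prop :=
  forall u v : V, (td G u v < +oo)%E.

(* The payoff of a player at [p] whose opponent is at [q]. *)
Definition payoff (V : finType) (G : temporal_graph V) (p q : V) : nat :=
  #|[set v | (td G p v < td G q v)%E]|.

Definition nash_equilibrium (V : finType) (G : temporal_graph V)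
    (p1 p2 : V) : Prop :=
  (forall q, payoff G q p2 <= payoff G p1 p2) /\
  (forall q, payoff G q p1 <= payoff G p2 p1).

(* Main.v *)
(** Explicit witnesses: a path on 8 vertices with 3 layers and a cycle on 7
    vertices with 2 layers (one edge of the cycle exists at time 1 only).
    Their temporal distances are given as tables, and [td u] is the only
    function d with d u = 0 such that every v <> u is reached at time d v from
    some w with d w < d v, and no edge lets a vertex be reached earlier.  Since
    the tables are bounded by M, this last condition is vacuous for edges at
    times t >= M, so it is a finite check; the absence of an equilibrium is then
    a finite check on the tables.  The path is treated as a cycle with one edge
    that is never present. *)
Require Import Defs.
From mathcomp Require Import all_boot.
From mathcomp Require Import all_algebra.
From mathcomp Require Import boolp constructive_ereal.

Set Implicit Arguments.
Unset Strict Implicit.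
Unset Printing Implicit Defensive.

(** Predecessors chain back to [u], so strong induction on [d v] builds a walk arriving at time
    [d v]. Induction on a walk, removing its last edge, shows that none arrives earlier. *)
Lemma td_charac (V : finType) (G : temporal_graph V) (u : V) (d : V -> nat) :
    d u = 0 ->
    (forall v, v != u ->
       exists2 w, d w < d v & [set w; v] \in tedges G (d v)) ->
    (forall w v t, d w < t -> [set w; v] \in tedges G t -> d v <= t) ->
  forall v, td G u v = ((d v)%:Z%:E)%R.
Proof.
move=> du0 d_pred d_min v; rewrite /td; have [<-|uv] := eqVneq u v.
  by rewrite du0.
have d_arrives w : w != u -> arrives G u w (d w).
  have [k] := ubnP (d w); elim: k w => // k IHk w /ltnSE-dwk wu.
  have [x dx xw] := d_pred w wu.
  have [xu|xu] := eqVneq x u.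
    apply/asboolP; exists [:: (w, d w)]; split=> //=.
    by rewrite /temporal_walk /= -xu xw !andbT (leq_ltn_trans _ dx).
  have /asboolP[s [walk_s last_s]] := IHk x (leq_trans dx dwk) xu.
  apply/asboolP; exists (rcons s (w, d w)); split; last by rewrite last_rcons.
  by rewrite /temporal_walk rcons_path last_s /= dx xw !andbT.
have le_arrives w t : arrives G u w t -> d w <= t.
  move=> /asboolP[s]; elim/last_ind: s w t => [|s [x tx] IHs] w t [] /=.
    by move=> _ [<- <-]; rewrite du0.
  rewrite /temporal_walk rcons_path last_rcons => /andP[walk_s].
  case E: (last _ s) => [y ty] /= /andP[lt_ty xy] [<- <-].
  by apply: d_min xy; apply: leq_ltn_trans lt_ty; apply: IHs.
case: pselect => [ex_t|[]]; last by exists (d v); apply: d_arrives; rewrite eq_sym.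
case: ex_minnP => t arr_t t_min; congr ((_ %:Z)%:E)%R.
apply/eqP; rewrite eqn_leq le_arrives // t_min //.
by apply: d_arrives; rewrite eq_sym.
Qed.

Lemma eq_set2 (T : finType) (a b c d : T) :
  ([set a; b] == [set c; d]) = (a == c) && (b == d) || (a == d) && (b == c).
Proof.
apply/eqP/idP => [E|/orP[]/andP[/eqP-> /eqP->] //]; last by rewrite setUC.
(* Each element of either pair lies in the other pair; the four comparisons then decide the
   claim. *)
have := (set21 a b, set22 a b, set21 c d, set22 c d).
rewrite E -{3 4}E !inE (eq_sym c a) (eq_sym d a) (eq_sym c b) (eq_sym d b).
by case=> -[[]]; do 4 case: eqP => _ //=.
Qed.

Lemma ordS_neq n (i : 'I_n.+2) : i != ordS i.
Proof.
rewrite -val_eqE /=; have [lt_i|ge_i] := ltnP i.+1 n.+2.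
  by rewrite modn_small // neq_ltn leqnn.
have -> : i = n.+1 :> nat by apply/eqP; rewrite eqn_leq -ltnS ltn_ord.
by rewrite modnn.
Qed.

(* The edge {i, i+1 mod n} is named by its endpoint i.  [ls] lists the layers
   at times 1, ..., size ls; the last one persists. *)
Definition layer (ls : seq (seq nat)) (t : nat) : seq nat :=
  nth (last [::] ls) ([::] :: ls) t.

Definition ring_edges n (l : seq nat) : {set {set 'I_n}} :=
  [set [set i; ordS i] | i : 'I_n & val i \in l].

Lemma ring_edges0 n ls : ring_edges n (layer ls 0) = set0.
Proof. by apply/setP => e; rewrite inE; apply/imsetP => -[i]; rewrite inE. Qed.

Lemma card_ring_edge n l e : e \in ring_edges n.+2 l -> #|e| = 2.
Proof. by case/imsetP => i _ ->; rewrite cards2 ordS_neq. Qed.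

Lemma ring_edges_lifetime n ls : exists tau, forall t, tau <= t ->
  ring_edges n (layer ls t) = ring_edges n (layer ls tau).
Proof.
(* This is the length of [[::] :: ls]; from there on [nth] returns its default, the last layer. *)
exists (size ls).+1 => t le_t.
by rewrite /layer !nth_default //= ltnW.
Qed.

Definition ring_graph n ls : temporal_graph 'I_n.+2 :=
  TemporalGraph (ring_edges0 n.+2 ls)
    (fun t e => @card_ring_edge n (layer ls t) e) (ring_edges_lifetime n.+2 ls).

Lemma underlying_ring n ls :
  underlying (ring_graph n ls) = ring_edges n.+2 (flatten ls).
Proof.
apply/setP => e; rewrite inE; apply/asboolP/imsetP => [[t /imsetP[i]]|[i]].
  rewrite inE => i_t ->; exists i => //; rewrite inE.
  apply/flattenP; exists (layer ls t) => //.
  have : layer ls t \in [::] :: ls.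
    rewrite /layer; have [?|?] := ltnP t (size ([::] :: ls)).
      exact: mem_nth.
    by rewrite nth_default // mem_last.
  by rewrite inE => /predU1P[E|//]; rewrite E in i_t.
(* The successor accounts for the empty layer at time 0. *)
rewrite inE => /flattenP[l l_ls i_l] ->; exists (index l ls).+1.
by apply/imsetP; exists i; rewrite // inE /layer /= nth_index.
Qed.

(** Only the index n - 1 is left out, the one where [ordS] wraps around; elsewhere [ordS] is the
    ordinary successor. *)
Lemma ring_edges_path n l : (forall k, (k \in l) = (k.+1 < n)) ->
  ring_edges n l =
    [set [set i; j] | i in 'I_n, j in 'I_n & j == i.+1 :> nat].
Proof.
move=> lE; apply/setP => e; apply/imsetP/imset2P => [[i]|[i j _]];
    rewrite !inE => ij ->.
  by exists i (ordS i) => //; rewrite inE /= modn_small // -lE.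
have lt_i : i.+1 < n by rewrite -(eqP ij).
exists i; first by rewrite inE lE.
by have -> : j = ordS i by apply: val_inj; rewrite /= modn_small ?(eqP ij).
Qed.

Lemma ring_edges_cycle n l : (forall k, k < n -> k \in l) ->
  ring_edges n l = [set [set i; ordS i] | i : 'I_n].
Proof.
move=> lE; apply/setP => e; apply/imsetP/imsetP => -[i _ ->]; exists i => //.
by rewrite inE lE ?ltn_ord.
Qed.

(** Stated on natural numbers so that adjacency can be evaluated; the two disjuncts say which
    endpoint names the edge. *)
Definition ring_adj n (l : seq nat) (x y : nat) : bool :=
  (x \in l) && (y == x.+1 %% n) || (y \in l) && (x == y.+1 %% n).

Lemma mem_ring_edges n l (x y : 'I_n) :
  ([set x; y] \in ring_edges n l) = ring_adj n l x y.
Proof.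
apply/imsetP/idP => [[i]|].
  rewrite inE => i_l /eqP; rewrite eq_set2 /ring_adj -!val_eqE /=.
  by case/orP => /andP[/eqP-> /eqP->]; rewrite i_l eqxx ?orbT.
case/orP => /andP[l_ /eqP E]; [exists x|exists y]; rewrite ?inE //.
  by apply/eqP; rewrite eq_set2 -!val_eqE /= -E !eqxx.
by apply/eqP; rewrite eq_set2 -!val_eqE /= -E !eqxx orbT.
Qed.

Definition ring_td_check n ls (d : nat -> nat -> nat) (M : nat) : bool :=
  all (fun u => (d u u == 0) && all (fun v =>
    [&& d u v <= M,
        (v != u) ==> has (fun w => (d u w < d u v) &&
          ring_adj n (layer ls (d u v)) w v) (iota 0 n) &
        all (fun w => all (fun t =>
          (d u w < t) && ring_adj n (layer ls t) w v ==> (d u v <= t))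
          (iota 0 M)) (iota 0 n)]) (iota 0 n)) (iota 0 n).

Lemma mem_iota_ord n (i : 'I_n) : val i \in iota 0 n.
Proof. by rewrite mem_iota /=. Qed.

Lemma td_ring n ls d M : ring_td_check n.+2 ls d M ->
  forall u v, td (ring_graph n ls) u v = ((d u v)%:Z%:E)%R.
Proof.
move=> /allP chk u; have /andP[/eqP du0 /allP {}chk] := chk _ (mem_iota_ord u).
apply: (@td_charac _ _ u (fun v => d u v)) => // [v vu|w v t].
  have /and3P[_ /implyP/(_ vu)/hasP[w]] := chk _ (mem_iota_ord v).
  rewrite mem_iota /= => lt_w /andP[dw adj_w] _.
  by exists (Ordinal lt_w) => //=; rewrite mem_ring_edges.
rewrite mem_ring_edges => dw adj_w.
have /and3P[le_M _ /allP/(_ _ (mem_iota_ord w))/allP] := chk _ (mem_iota_ord v).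
have [lt_t|le_t] := ltnP t M; last by move=> _; apply: leq_trans le_t.
by move/(_ t); rewrite mem_iota /= lt_t dw adj_w => /(_ isT).
Qed.

Definition table_payoff n (d : nat -> nat -> nat) (p q : nat) : nat :=
  count (fun v => d p v < d q v) (iota 0 n).

Lemma payoff_table n (G : temporal_graph 'I_n) (d : nat -> nat -> nat) :
    (forall u v, td G u v = ((d u v)%:Z%:E)%R) ->
  forall p q, payoff G p q = table_payoff n d p q.
Proof.
move=> tdE p q; rewrite /payoff /table_payoff -val_enum_ord count_map.
rewrite cardsE cardE [in LHS]/enum_mem size_filter -enumT.
by apply: eq_count => v; rewrite -[LHS]/(td G p v < td G q v)%E !tdE lte_fin ltz_nat.
Qed.

Definition no_nash_check n (d : nat -> nat -> nat) : bool :=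
  let f := table_payoff n d in
  all (fun p => all (fun q => has (fun r => (f p q < f r q) || (f q p < f r p))
    (iota 0 n)) (iota 0 n)) (iota 0 n).

Lemma no_nash n (G : temporal_graph 'I_n) (d : nat -> nat -> nat) :
    (forall u v, td G u v = ((d u v)%:Z%:E)%R) -> no_nash_check n d ->
  ~ exists p1 p2, nash_equilibrium G p1 p2.
Proof.
move=> tdE /allP chk [p [q [p_best q_best]]].
have /allP/(_ _ (mem_iota_ord q))/hasP[r] := chk _ (mem_iota_ord p).
rewrite mem_iota /= => lt_r /orP[].
  by have := p_best (Ordinal lt_r); rewrite !(payoff_table tdE) ltnNge => ->.
by have := q_best (Ordinal lt_r); rewrite !(payoff_table tdE) ltnNge => ->.
Qed.

Definition lookup (s : seq (seq nat)) (u v : nat) : nat := nth 0 (nth [::] s u) v.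

(** Edge 7, which would join vertices 7 and 0, is in no layer. From time 3 on the whole path is
    present. *)
Definition path_layers : seq (seq nat) :=
  [:: [:: 1; 2; 3; 4]; [:: 2; 3; 4; 5]; iota 0 7].

Definition path_td : nat -> nat -> nat := lookup
 [::
   [:: 0; 3; 4; 5; 6; 7; 8; 9];
   [:: 3; 0; 1; 2; 3; 4; 5; 6];
   [:: 3; 1; 0; 1; 2; 3; 4; 5];
   [:: 4; 3; 1; 0; 1; 2; 3; 4];
   [:: 4; 3; 2; 1; 0; 1; 2; 3];
   [:: 5; 4; 3; 2; 1; 0; 2; 3];
   [:: 7; 6; 5; 4; 3; 2; 0; 3];
   [:: 9; 8; 7; 6; 5; 4; 3; 0]].

(** Edge 2, joining vertices 2 and 3, exists at time 1 only. From time 2 on the graph is the path 3,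
    4, 5, 6, 0, 1, 2, which ensures connectivity. *)
Definition cycle_layers : seq (seq nat) :=
  [:: [:: 0; 1; 2]; [:: 0; 1; 3; 4; 5; 6]].

Definition cycle_td : nat -> nat -> nat := lookup
 [::
   [:: 0; 1; 2; 5; 4; 3; 2];
   [:: 1; 0; 1; 5; 4; 3; 2];
   [:: 2; 1; 0; 1; 2; 3; 3];
   [:: 3; 2; 1; 0; 2; 3; 4];
   [:: 4; 5; 6; 2; 0; 2; 3];
   [:: 3; 4; 5; 3; 2; 0; 2];
   [:: 2; 3; 4; 4; 3; 2; 0]].

Lemma td_path (u v : 'I_8) :
  td (ring_graph 6 path_layers) u v = ((path_td u v)%:Z%:E)%R.
(* The number 10 is a bound M on the table, whose largest entry is 9. *)
Proof. by apply: (@td_ring 6 _ path_td 10); vm_compute. Qed.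

Lemma td_cycle (u v : 'I_7) :
  td (ring_graph 5 cycle_layers) u v = ((cycle_td u v)%:Z%:E)%R.
Proof. by apply: (@td_ring 5 _ cycle_td 10); vm_compute. Qed.

Theorem theorem32 :
  (exists (V : finType) (P : temporal_graph V),
     [/\ temporal_path P, temporally_connected P &
         ~ exists p1 p2 : V, nash_equilibrium P p1 p2]) /\
  (exists (V : finType) (C : temporal_graph V),
     [/\ temporal_cycle C, temporally_connected C &
         ~ exists p1 p2 : V, nash_equilibrium C p1 p2]).
Proof.
split.
  exists 'I_8, (ring_graph 6 path_layers); split.
  - exists 8, id; split=> //; first by exists id.
    rewrite underlying_ring; apply: ring_edges_path => k.
    (* The indices below 8 are checked one by one; for all larger ones both sides compute to
       false. *)
    by do 8 case: k => [|k] //.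
  - by move=> u v; rewrite td_path ltry.
  - by apply: no_nash td_path _; vm_compute.
exists 'I_7, (ring_graph 5 cycle_layers); split.
- exists 7, id; split=> //; first by exists id.
  rewrite underlying_ring; apply: ring_edges_cycle => k.
  by do 7 case: k => [|k] //.
- by move=> u v; rewrite td_cycle ltry.
- by apply: no_nash td_cycle _; vm_compute.
Qed.
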